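(* Let $k\ge 2$, let $V=\{v_1,\dots,v_n\}$ be partitioned into clusters $\mathcal C_1,\dots,\mathcal C_k$ all of the same size $|\mathcal C|\ge 2$ (so $n=k|\mathcal C|$), and let $p_{\mathrm{in}}^+,p_{\mathrm{out}}^+,p_{\mathrm{in}}^-,p_{\mathrm{out}}^-\in[0,1]$ be such that the expected overall degree $|\mathcal C|\big(p_{\mathrm{in}}^++p_{\mathrm{in}}^-+(k-1)(p_{\mathrm{out}}^++p_{\mathrm{out}}^-)\big)$ is positive. Let $\mathcal W^+,\mathcal W^-$ be the expected weight matrices of the signed stochastic block model with these parameters, and let $$\mathcal L_{BN}=\bar{\mathcal D}^{-1}\big(\mathcal D^+-\mathcal W^++\mathcal W^-\big),\qquad \mathcal L_{SN}=\bar{\mathcal D}^{-1/2}\big(\bar{\mathcal D}-\mathcal W^++\mathcal W^-\big)\bar{\mathcal D}^{-1/2}$$ be the balance normalized Laplacian and the signed normalized Laplacian of the expected graphs. Let $\boldsymbol\chi_1=\mathbf 1$ and $\boldsymbol\chi_i=(k-1)\mathbf 1_{\mathcal C_i}-\mathbf 1_{\overline{\mathcal C_i}}$ for $i=2,\dots,k$. Then the following statements are equivalent: 1. $\boldsymbol\chi_1,\dots,\boldsymbol\chi_k$ are the eigenvectors corresponding to the $k$ smallest eigenvalues of $\mathcal L_{BN}$. 2. $\boldsymbol\chi_1,\dots,\boldsymbol\chi_k$ are the eigenvectors corresponding to the $k$ smallest eigenvalues of $\mathcal L_{SN}$. 3. The two conditions $p_{\mathrm{in}}^-+p_{\mathrm{out}}^+<p_{\mathrm{in}}^++p_{\mathrm{out}}^-$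 and $p_{\mathrm{in}}^-+(k-1)p_{\mathrm{out}}^-<p_{\mathrm{in}}^++(k-1)p_{\mathrm{out}}^+$ hold simultaneously.
   Context: Expected signed stochastic block model: $\mathcal W^+$ and $\mathcal W^-$ are the $n\times n$ matrices with $\mathcal W^{+}_{ij}=p_{\mathrm{in}}^{+}$ and $\mathcal W^{-}_{ij}=p_{\mathrm{in}}^{-}$ if $v_i,v_j$ belong to the same cluster (including $i=j$), and $\mathcal W^{+}_{ij}=p_{\mathrm{out}}^{+}$, $\mathcal W^{-}_{ij}=p_{\mathrm{out}}^{-}$ if $v_i,v_j$ belong to different clusters. $\mathcal D^+$ is the diagonal matrix with $\mathcal D^+_{ii}=\sum_j\mathcal W^+_{ij}$ and $\bar{\mathcal D}$ is the diagonal matrix with $\bar{\mathcal D}_{ii}=\sum_j(\mathcal W^+_{ij}+\mathcal W^-_{ij})$. Notation: $\mathbf 1\in\mathbb R^n$ is the all-ones vector, $\mathbf 1_S$ is the indicator vector of $S\subseteq V$, and $\overline{S}=V\setminus S$. Convention: for a symmetric matrix $M\in\mathbb R^{n\times n}$, ''$\boldsymbol\chi_1,\dots,\boldsymbol\chi_k$ are the eigenvectors corresponding to the $k$ smallest eigenvalues of $M$'' means that each $\boldsymbol\chi_i$ is an eigenvector of $M$ and its eigenvalue is strictly smaller than each of the remaining $n-k$ eigenvalues of $M$, i.e. the eigenvalues of $M$ restricted to the orthogonal complement of $\mathrm{span}\{\boldsymbol\chi_1,\dots,\boldsymbol\chi_k\}$. (Since all clusters have equal size, $\mathcal D^+$ and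 $\bar{\mathcal D}$ are multiples of the identity, so $\mathcal L_{BN}$ is symmetric.) *)

(* Defs.v *)
From mathcomp Require Import all_boot all_order all_algebra.

Set Implicit Arguments.
Unset Strict Implicit.
Unset Printing Implicit Defensive.

Import Order.TTheory GRing.Theory Num.Theory.
Local Open Scope ring_scope.

(* Injectivity matters: [partition] only sees the set of blocks, so without it
   two labels could name the same cluster. *)
Definition is_clustering (n k : nat) (C : 'I_k -> {set 'I_n}) : Prop :=
  injective C /\ partition [set C a | a : 'I_k] [set: 'I_n].

Definition same_cluster (n k : nat) (C : 'I_k -> {set 'I_n}) (i j : 'I_n) : bool :=
  [exists a : 'I_k, (i \in C a) && (j \in C a)].

Section Laplacians.
Variables (R : rcfType) (n : nat).

(* [W] is the expected positive (resp. negative) weight matrix when the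
   parameters are the positive (resp. negative) edge probabilities. The diagonal
   carries [p_in]: self-loops are included. *)
Definition esbm_weights (k : nat) (C : 'I_k -> {set 'I_n}) (p_in p_out : R) :
    'M[R]_n :=
  \matrix_(i, j) if same_cluster C i j then p_in else p_out.

Definition degrees (W : 'M[R]_n) : 'rV[R]_n := \row_i \sum_j W i j.

Definition balance_normalized_laplacian (Wp Wm : 'M[R]_n) : 'M[R]_n :=
  invmx (diag_mx (degrees (Wp + Wm))) *m (diag_mx (degrees Wp) - Wp + Wm).

(* The matrix [S] below is the square root of the (nonnegative) total degree
   matrix. *)
Definition signed_normalized_laplacian (Wp Wm : 'M[R]_n) : 'M[R]_n :=
  let S := diag_mx (map_mx Num.sqrt (degrees (Wp + Wm))) in
  invmx S *m (diag_mx (degrees (Wp + Wm)) - Wp + Wm) *m invmx S.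

Definition indicator (A : {set 'I_n}) : 'cV[R]_n := \col_i (i \in A)%:R.

(* Indices are shifted by one: label 0 is the first cluster, and gets the
   all-ones vector. *)
Definition cluster_vector (k : nat) (C : 'I_k -> {set 'I_n}) (a : 'I_k) :
    'cV[R]_n :=
  if val a == 0%N then const_mx 1
  else (k%:R - 1) *: indicator (C a) - indicator (~: C a).

(* Right (column) eigenvectors; mathcomp's [eigenvalue] is about row vectors. *)
Definition eigenpair (M : 'M[R]_n) (lambda : R) (v : 'cV[R]_n) : Prop :=
  v != 0 /\ M *m v = lambda *: v.

(* Meant for symmetric [M]. When the [chi a] are eigenvectors of such an [M],
   the orthogonal complement of their span is [M]-stable, and the eigenvalues of
   the restriction of [M] to it are exactly the [mu] quantified over here. *)
Definition eigenvectors_of_smallest (k : nat) (M : 'M[R]_n)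
    (chi : 'I_k -> 'cV[R]_n) : Prop :=
  exists lambda : 'I_k -> R,
    (forall a, eigenpair M (lambda a) (chi a)) /\
    (forall (mu : R) (w : 'cV[R]_n),
       (forall a, (chi a)^T *m w = 0) -> eigenpair M mu w ->
       forall a, lambda a < mu).

End Laplacians.

Arguments cluster_vector R {n k} C a.

(* Main.v *)
(** Every operator in sight is [c (e I - A)] with [c > 0] and [A] a block matrix with
    entries [p] inside and [q] outside the clusters. The vector [1] is an eigenvector of [A]
    for [m (p + (k - 1) q)], each other cluster vector is one for [m (p - q)], and [A]
    vanishes on the vectors orthogonal to all of them, because such vectors sum to zero
    over each cluster. As [m >= 2], the difference of two basis vectors of one
    cluster is such a vector, so the spectral gap holds exactly when both eigenvalues of
    [A] are positive. *)
Require Import Defs.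
From mathcomp Require Import all_boot all_order all_algebra ring lra.

Set Implicit Arguments.
Unset Strict Implicit.
Unset Printing Implicit Defensive.

Import Order.TTheory GRing.Theory Num.Theory.
Local Open Scope ring_scope.

(** Turns membership in a cluster into an equality of labels. A label exists because the blocks
    cover everything. It is unique because distinct blocks are disjoint and, by injectivity,
    distinct labels name distinct blocks. *)
Lemma clustering_label (n k : nat) (C : 'I_k -> {set 'I_n}) :
  is_clustering C ->
  exists lab : 'I_n -> 'I_k, forall i a, (i \in C a) = (lab i == a).
Proof.
move=> [injC /and3P[/eqP covC /trivIsetP trivC _]].
have exC i : exists a, i \in C a.
  have: i \in [set: 'I_n] by rewrite inE.
  by rewrite -covC => /bigcupP[_ /imsetP[a _ ->] ia]; exists a.
have [lab labP] := fin_all_exists exC.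
exists lab => i a; apply/idP/eqP => [ia | <- //].
apply/eqP/contraT => neq.
have neqC : C (lab i) != C a by rewrite (inj_eq injC).
have CaP b : C b \in [set C a | a : 'I_k] by apply: imset_f.
by have /disjointFr/(_ (labP i)) := trivC _ _ (CaP _) (CaP _) neqC; rewrite ia.
Qed.

(** Used to read off an eigenvalue from a nonzero eigenvector. *)
Lemma scaler_injl (F : fieldType) (V : lmodType F) (v : V) :
  v != 0 -> injective (fun a : F => a *: v).
Proof.
move=> v_neq0 a b /eqP; rewrite -subr_eq0 -scalerBl scaler_eq0 (negPf v_neq0) orbF.
by rewrite subr_eq0 => /eqP.
Qed.

Section BlockMatrix.
Variables (R : rcfType) (n k m : nat) (C : 'I_k -> {set 'I_n}).
Hypotheses (hC : is_clustering C) (hsize : forall a, #|C a| = m).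

Lemma esbm_weightsB (p q p' q' : R) :
  esbm_weights C p q - esbm_weights C p' q' = esbm_weights C (p - p') (q - q').
Proof. by apply/matrixP => i j; rewrite !mxE; case: ifP. Qed.

Lemma esbm_weightsD (p q p' q' : R) :
  esbm_weights C p q + esbm_weights C p' q' = esbm_weights C (p + p') (q + q').
Proof. by apply/matrixP => i j; rewrite !mxE; case: ifP. Qed.

Lemma sum_clusters (v : 'I_n -> R) : \sum_i v i = \sum_a \sum_(i in C a) v i.
Proof.
have [lab labE] := clustering_label hC.
rewrite (partition_big lab xpredT) //=; apply: eq_bigr => a _.
by apply: eq_bigl => i; rewrite labE.
Qed.

(** The block matrix is [p - q] times the same-cluster indicator plus [q] times the all-ones matrix,
    so its action depends on [v] only through the cluster sums. *)
Lemma esbm_weights_row_sum (p q : R) (v : 'I_n -> R) i a : i \in C a ->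
  \sum_j esbm_weights C p q i j * v j
    = (p - q) * (\sum_(j in C a) v j) + q * \sum_j v j.
Proof.
have [lab labE] := clustering_label hC; move=> ia.
have sameE j : same_cluster C i j = (j \in C a).
  move: ia; rewrite !labE => /eqP <-; apply/existsP/eqP => [[b]|eq_lab].
    by rewrite !labE => /andP[/eqP -> /eqP].
  by exists (lab j); rewrite !labE eq_lab !eqxx.
rewrite [X in (p - q) * X]big_mkcond !mulr_sumr -big_split /=; apply: eq_bigr => j _.
by rewrite mxE sameE; case: ifP => _; rewrite ?mulr0 ?add0r // -mulrDl subrK.
Qed.

Lemma card_clusters : n%:R = k%:R * m%:R :> R.
Proof.
have := sum_clusters (fun=> 1).
rewrite sumr_const card_ord => ->.
under eq_bigr do rewrite sumr_const hsize.
by rewrite sumr_const card_ord mulr_natl.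
Qed.

Lemma degrees_esbm_weights (p q : R) :
  degrees (esbm_weights C p q) = const_mx (m%:R * (p + (k%:R - 1) * q)).
Proof.
have [lab labE] := clustering_label hC.
apply/rowP => i; rewrite !mxE.
have ia : i \in C (lab i) by rewrite labE.
have := esbm_weights_row_sum p q (fun=> 1) ia.
under eq_bigr do rewrite mulr1.
move=> ->; rewrite !sumr_const hsize card_ord card_clusters; ring.
Qed.

Lemma cluster_vectorE a i :
  cluster_vector R C a i 0
    = if val a == 0%N then 1 else k%:R * (i \in C a)%:R - 1.
Proof.
rewrite /cluster_vector; case: ifP => _; rewrite !mxE ?inE //.
by case: (i \in C a) => /=; ring.
Qed.

Lemma sum_cluster_vector a (w : 'cV[R]_n) :
  ((cluster_vector R C a)^T *m w) 0 0
    = if val a == 0%N then \sum_i w i 0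
      else k%:R * (\sum_(i in C a) w i 0) - \sum_i w i 0.
Proof.
rewrite mxE; under eq_bigr do rewrite mxE cluster_vectorE.
case: ifP => _; first by apply: eq_bigr => i _; rewrite mul1r.
rewrite (big_mkcond (mem (C a))) mulr_sumr -sumrB; apply: eq_bigr => i _ /=.
by case: (i \in C a) => /=; ring.
Qed.

Lemma cluster_vector_orthogonalP (w : 'cV[R]_n) : (0 < k)%N ->
  (forall a, (cluster_vector R C a)^T *m w = 0) <->
  (forall a, \sum_(i in C a) w i 0 = 0).
Proof.
move=> k_gt0; split=> [orth|sumw0 a]; last first.
  apply/matrixP => i j; rewrite !ord1 sum_cluster_vector sum_clusters !sumw0.
  by rewrite big1 => [|b _]; rewrite ?sumw0 // mulr0 subr0 mxE if_same.
have sum0 : \sum_i w i 0 = 0.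
  by have := sum_cluster_vector (Ordinal k_gt0) w; rewrite orth mxE.
have sum_pos a : val a != 0%N -> \sum_(i in C a) w i 0 = 0.
  move=> /negPf a_neq0; have := sum_cluster_vector a w.
  rewrite orth mxE a_neq0 sum0 subr0 => /esym/eqP.
  by rewrite mulf_eq0 pnatr_eq0 -[k == 0%N]negbK -lt0n k_gt0 => /eqP.
move=> a; have [a0|/sum_pos //] := eqVneq (val a) 0%N.
(* The first cluster has no vector of its own: its sum is the total, which is zero, minus the sums
   over the other clusters, already known to vanish. *)
rewrite -[RHS]sum0 sum_clusters [RHS](bigD1 a) //= [X in _ + X]big1 ?addr0 //.
move=> b b_neq_a; apply: sum_pos; apply: contra_neq b_neq_a => b0; apply: val_inj.
by rewrite /= b0.
Qed.

Lemma esbm_weights_orthogonal (p q : R) (w : 'cV[R]_n) :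
  (forall a, \sum_(i in C a) w i 0 = 0) -> esbm_weights C p q *m w = 0.
Proof.
have [lab labE] := clustering_label hC.
move=> sumw0; apply/colP => i; rewrite mxE [RHS]mxE.
have ia : i \in C (lab i) by rewrite labE.
rewrite (esbm_weights_row_sum p q (fun j => w j 0) ia) sumw0 sum_clusters.
by rewrite big1 ?mulr0 ?addr0.
Qed.

Lemma esbm_weights_cluster_vector (p q : R) a :
  esbm_weights C p q *m cluster_vector R C a
    = (m%:R * (if val a == 0%N then p + (k%:R - 1) * q else p - q))
        *: cluster_vector R C a.
Proof.
have [lab labE] := clustering_label hC.
apply/colP => i; rewrite mxE [RHS]mxE.
have ib : i \in C (lab i) by rewrite labE.
rewrite (esbm_weights_row_sum p q (fun j => cluster_vector R C a j 0) ib).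
(* A cluster vector is constant on each cluster, so a cluster sum is [m] times that constant. *)
have sumE b : \sum_(j in C b) cluster_vector R C a j 0
    = m%:R * (if val a == 0%N then 1 else k%:R * (b == a)%:R - 1).
  rewrite (eq_bigr (fun=> if val a == 0%N then 1 else k%:R * (b == a)%:R - 1)).
    by rewrite sumr_const hsize [RHS]mulr_natl.
  by move=> j; rewrite cluster_vectorE !labE => /eqP ->.
rewrite sum_clusters; under [X in _ + _ * X]eq_bigr do rewrite sumE.
rewrite sumE cluster_vectorE labE; case: ifP => _.
  rewrite sumr_const card_ord -mulr_natl; ring.
(* Every cluster vector other than the all-ones one has total zero, so the [q] term of the row sum
   drops out. *)
have -> : \sum_b m%:R * (k%:R * (b == a)%:R - 1) = 0 :> R.
  rewrite -mulr_sumr sumrB -mulr_sumr sumr_const card_ord (bigD1 a) //= eqxx.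
  by rewrite big1 => [|b /negPf -> //]; rewrite addr0 mulr1 subrr mulr0.
ring.
Qed.

Lemma cluster_vector_neq0 a : (1 < k)%N -> (0 < m)%N -> cluster_vector R C a != 0.
Proof.
move=> k_gt1 m_gt0.
have /card_gt0P[i ia] : (0 < #|C a|)%N by rewrite hsize.
(* At a vertex of its own cluster the entry is [1] or [k - 1], and [k > 1]. *)
apply/eqP => /colP/(_ i); rewrite cluster_vectorE mxE ia mulr1.
case: ifP => _ /eqP; first by rewrite oner_eq0.
by rewrite subr_eq0 pnatr_eq1 gtn_eqF.
Qed.

(** The shift [e] moves all eigenvalues together and so leaves the gap alone. This lets one
    statement serve both Laplacians, which differ only in [e]. *)
Lemma eigenvectors_of_smallest_esbm (c e p q : R) :
  (1 < k)%N -> (1 < m)%N -> 0 < c ->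
  eigenvectors_of_smallest (c *: (e%:M - esbm_weights C p q)) (cluster_vector R C)
    <-> q < p /\ 0 < p + (k%:R - 1) * q.
Proof.
move=> k_gt1 m_gt1 c_gt0; have k_gt0 := ltnW k_gt1; have m_gt0 := ltnW m_gt1.
set M := c *: _.
pose s (a : 'I_k) := m%:R * (if val a == 0%N then p + (k%:R - 1) * q else p - q).
have Mchi a : M *m cluster_vector R C a = (c * (e - s a)) *: cluster_vector R C a.
  rewrite -scalemxAl mulmxBl mul_scalar_mx esbm_weights_cluster_vector -scalerBl.
  by rewrite scalerA.
have Morth (w : 'cV[R]_n) :
    (forall a, \sum_(i in C a) w i 0 = 0) -> M *m w = (c * e) *: w.
  move=> sumw0; rewrite -scalemxAl mulmxBl mul_scalar_mx esbm_weights_orthogonal //.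
  by rewrite subr0 scalerA.
have gapE a : (c * (e - s a) < c * e) = (0 < s a).
  by rewrite ltr_pM2l // gtrDl oppr_lt0.
have m_gt0R : 0 < m%:R :> R by rewrite ltr0n.
split=> [[lambda [eig gap]]|[hpq hpk]]; last first.
  exists (fun a => c * (e - s a)); split=> [a|mu w orth [w_neq0 Mw] a].
    by split; [apply: cluster_vector_neq0 | apply: Mchi].
  move: orth => /(cluster_vector_orthogonalP w k_gt0)/Morth.
  rewrite Mw => /(scaler_injl w_neq0) ->.
  by rewrite gapE /s; case: ifP => _; rewrite mulr_gt0 ?subr_gt0.
(* The eigenvalues supplied by the hypothesis are existential, but nonzero eigenvectors determine
   them. *)
have lambdaE a : lambda a = c * (e - s a).
  have [chi_neq0 Mchi'] := eig a.
  by move: Mchi'; rewrite Mchi => /(scaler_injl chi_neq0) ->.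
have s_gt0 a : 0 < s a.
  (* Any cluster would do here. Two distinct vertices in it yield a nonzero vector orthogonal to all
     cluster vectors, so the gap condition is not vacuous and compares [lambda a] with [c * e]. *)
  have /card_gt1P[i [j [ia ja i_neq_j]]] : (1 < #|C (Ordinal k_gt0)|)%N.
    by rewrite hsize.
  have [lab labE] := clustering_label hC.
  pose w : 'cV[R]_n := delta_mx i 0 - delta_mx j 0.
  have sumw0 b : \sum_(l in C b) w l 0 = 0.
    have sum_delta t : \sum_(l in C b) (delta_mx t 0 : 'cV[R]_n) l 0 = (t \in C b)%:R.
      rewrite big_mkcond (bigD1 t) //= big1 => [|l /negPf l_neq_t].
        by rewrite mxE !eqxx addr0; case: ifP.
      by rewrite mxE l_neq_t if_same.
    rewrite (eq_bigr (fun l => (delta_mx i 0 : 'cV[R]_n) l 0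
                              - (delta_mx j 0 : 'cV[R]_n) l 0)).
      rewrite sumrB !sum_delta !labE; move: ia ja.
      by rewrite !labE => /eqP -> /eqP ->; rewrite subrr.
    by move=> l _; rewrite /w !mxE.
  have w_neq0 : w != 0.
    apply/eqP => /colP/(_ i)/eqP.
    by rewrite !mxE !eqxx (negPf i_neq_j) subr0 oner_eq0.
  rewrite -gapE -lambdaE; apply: (gap _ w); last by split=> //; exact: Morth.
  exact/(cluster_vector_orthogonalP w k_gt0).
split.
  (* Label 1 exists since [k > 1] and gives [p - q]; label 0 gives the eigenvalue of the all-ones
     vector. *)
  have := s_gt0 (Ordinal k_gt1).
  by rewrite /s /= pmulr_rgt0 // subr_gt0.
by have := s_gt0 (Ordinal k_gt0); rewrite /s /= pmulr_rgt0.
Qed.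

End BlockMatrix.

Theorem theorem2 (R : rcfType) (n k m : nat) (C : 'I_k -> {set 'I_n})
    (p_in_pos p_out_pos p_in_neg p_out_neg : R)
    (hk : (2 <= k)%N)
    (hC : is_clustering C)
    (hm : (2 <= m)%N)
    (hsize : forall a : 'I_k, #|C a| = m)
    (h_in_pos : 0 <= p_in_pos <= 1)
    (h_out_pos : 0 <= p_out_pos <= 1)
    (h_in_neg : 0 <= p_in_neg <= 1)
    (h_out_neg : 0 <= p_out_neg <= 1)
    (hdeg : 0 < m%:R * (p_in_pos + p_in_neg
                        + (k%:R - 1) * (p_out_pos + p_out_neg))) :
  let Wp := esbm_weights C p_in_pos p_out_pos in
  let Wm := esbm_weights C p_in_neg p_out_neg in
  [<-> eigenvectors_of_smallest (balance_normalized_laplacian Wp Wm)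
         (cluster_vector R C);
       eigenvectors_of_smallest (signed_normalized_laplacian Wp Wm)
         (cluster_vector R C);
       p_in_neg + p_out_pos < p_in_pos + p_out_neg /\
       p_in_neg + (k%:R - 1) * p_out_neg < p_in_pos + (k%:R - 1) * p_out_pos].
Proof.
move=> Wp Wm.
set d := (X in 0 < X) in hdeg.
have degE : degrees (Wp + Wm) = const_mx d.
  by rewrite esbm_weightsD (degrees_esbm_weights hC hsize).
have d_ge0 : 0 <= d by rewrite ltW.
(* Equal cluster sizes make both degree matrices scalar; here the shift [e] is the positive
   degree. *)
have BN : balance_normalized_laplacian Wp Wm
    = d^-1 *: ((m%:R * (p_in_pos + (k%:R - 1) * p_out_pos))%:M - (Wp - Wm)).
  rewrite /balance_normalized_laplacian degE (degrees_esbm_weights hC hsize).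
  by rewrite !diag_const_mx invmx_scalar mul_scalar_mx opprB addrA addrAC.
(* The two inverse square roots are scalar, hence merge into [d^-1]; here the shift is the total
   degree [d]. *)
have SN : signed_normalized_laplacian Wp Wm = d^-1 *: (d%:M - (Wp - Wm)).
  rewrite /signed_normalized_laplacian degE map_const_mx !diag_const_mx.
  rewrite invmx_scalar mul_scalar_mx mul_mx_scalar scalerA -invfM -expr2.
  by rewrite sqr_sqrtr // opprB addrA addrAC.
have dV_gt0 : 0 < d^-1 by rewrite invr_gt0.
have cond : (p_out_pos - p_out_neg < p_in_pos - p_in_neg /\
    0 < p_in_pos - p_in_neg + (k%:R - 1) * (p_out_pos - p_out_neg)) <->
  (p_in_neg + p_out_pos < p_in_pos + p_out_neg /\
    p_in_neg + (k%:R - 1) * p_out_neg < p_in_pos + (k%:R - 1) * p_out_pos).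
  by split=> -[h1 h2]; split; lra.
rewrite BN SN esbm_weightsB.
have BN_iff := eigenvectors_of_smallest_esbm hC hsize
  (m%:R * (p_in_pos + (k%:R - 1) * p_out_pos))
  (p_in_pos - p_in_neg) (p_out_pos - p_out_neg) hk hm dV_gt0.
have SN_iff := eigenvectors_of_smallest_esbm hC hsize d
  (p_in_pos - p_in_neg) (p_out_pos - p_out_neg) hk hm dV_gt0.
by tfae=> [/BN_iff/SN_iff|/SN_iff/cond|/cond/BN_iff].
Qed.
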